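(* Let $\mathcal{A}\in\mathbb{C}^{\mathbf{I}(N)\times\mathbf{I}(N)}$ with $\mathrm{ind}(\mathcal{A})=k$, and let $\mathcal{B}\in\mathbb{C}^{\mathbf{I}(N)}$ with $\mathcal{B}\in\mathfrak{R}(\mathcal{A}^k)$. Then the set of all solutions $\mathcal{X}\in\mathbb{C}^{\mathbf{I}(N)}$ of the equation $$\mathcal{A}^{2k}*_N\mathcal{X}=\mathcal{A}^{k}*_N\mathcal{B}$$ is $(\mathcal{A}^{k})^{D}*_N\mathcal{B}+\mathcal{N}(\mathcal{A}^{k})$.
   Context: For positive integers $I_1,\dots,I_N$ write $\mathbf{I}(N)=I_1\times\cdots\times I_N$; $\mathbb{C}^{\mathbf{I}(N)\times\mathbf{J}(N)}$ is the set of complex tensors with entries $a_{i_1\dots i_N j_1\dots j_N}$, $1\le i_s\le I_s$, $1\le j_s\le J_s$. The Einstein product of $\mathcal{A}\in\mathbb{C}^{\mathbf{I}(N)\times\mathbf{K}(N)}$ and $\mathcal{B}\in\mathbb{C}^{\mathbf{K}(N)\times\mathbf{J}(N)}$ is $(\mathcal{A}*_N\mathcal{B})_{i_1\dots i_N j_1\dots j_N}=\sum_{k_1,\dots,k_N}a_{i_1\dots i_N k_1\dots k_N}b_{k_1\dots k_N j_1\dots j_N}$; for $\mathcal{X}\in\mathbb{C}^{\mathbf{K}(N)}$, $(\mathcal{A}*_N\mathcal{X})_{i_1\dots i_N}=\sum_{k_1,\dots,k_N}a_{i_1\dots i_N k_1\dots k_N}x_{k_1\dots k_N}$. Powers of $\mathcal{A}\in\mathbb{C}^{\mathbf{I}(N)\times\mathbf{I}(N)}$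 are taken with $*_N$, and $\mathcal{A}^0$ is the identity tensor. The range and null space are $\mathfrak{R}(\mathcal{A})=\{\mathcal{A}*_N\mathcal{X}:\mathcal{X}\in\mathbb{C}^{\mathbf{I}(N)}\}$ and $\mathcal{N}(\mathcal{A})=\{\mathcal{X}\in\mathbb{C}^{\mathbf{I}(N)}:\mathcal{A}*_N\mathcal{X}=\mathcal{O}\}$. The index $\mathrm{ind}(\mathcal{A})$ is the smallest nonnegative integer $k$ with $\mathfrak{R}(\mathcal{A}^k)=\mathfrak{R}(\mathcal{A}^{k+1})$. The Drazin inverse $\mathcal{A}^D$ of $\mathcal{A}$ with $\mathrm{ind}(\mathcal{A})=k$ is the (unique, always existing) tensor $\mathcal{X}\in\mathbb{C}^{\mathbf{I}(N)\times\mathbf{I}(N)}$ with $\mathcal{A}^{k+1}*_N\mathcal{X}=\mathcal{A}^k$, $\mathcal{X}*_N\mathcal{A}*_N\mathcal{X}=\mathcal{X}$, $\mathcal{A}*_N\mathcal{X}=\mathcal{X}*_N\mathcal{A}$. *)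

(* Defs.v *)
From mathcomp Require Import all_boot all_order all_algebra.
From mathcomp Require Import boolp classical_sets.

Set Implicit Arguments.
Unset Strict Implicit.
Unset Printing Implicit Defensive.

Import GRing.Theory.
Local Open Scope ring_scope.
Local Open Scope classical_set_scope.

(* Multi-indices (i_1, ..., i_N) with i_s ranging over I_s values; both the
   position s and the entries i_s are numbered from 0. *)
Notation midx I := {dffun forall s, 'I_(I s)}.

(* C^I(N), and C^(I(N) x J(N)) with entry a_{i_1...i_N j_1...j_N} = A (i, j). *)
Notation tensor C I := {ffun midx I -> C}.
Notation tensor2 C I J := {ffun midx I * midx J -> C}.

Section EinsteinProduct.
Variables (C : comNzRingType) (N : nat).
Implicit Types I J K : 'I_N -> nat.

Definition einstein I K J (A : tensor2 C I K) (B : tensor2 C K J) :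
    tensor2 C I J :=
  [ffun ij => \sum_(k : midx K) A (ij.1, k) * B (k, ij.2)].

Definition einstein_app I K (A : tensor2 C I K) (X : tensor C K) : tensor C I :=
  [ffun i => \sum_(k : midx K) A (i, k) * X k].

Definition tensor_id I : tensor2 C I I := [ffun ij => (ij.1 == ij.2)%:R].

Definition tensor_pow I (A : tensor2 C I I) (n : nat) : tensor2 C I I :=
  iter n (einstein A) (tensor_id I).

Definition tensor_range I (A : tensor2 C I I) : set (tensor C I) :=
  [set einstein_app A X | X in setT].

Definition tensor_null I (A : tensor2 C I I) : set (tensor C I) :=
  [set X | einstein_app A X = 0].

Definition is_tensor_index I (A : tensor2 C I I) (k : nat) : Prop :=
  tensor_range (tensor_pow A k) = tensor_range (tensor_pow A k.+1) /\
  forall j, tensor_range (tensor_pow A j) = tensor_range (tensor_pow A j.+1) ->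
    (k <= j)%N.

(* Over a field the index and the Drazin inverse always exist and are unique,
   so the default values given to [xget] are never used. *)
Definition tensor_index I (A : tensor2 C I I) : nat :=
  xget 0%N [set k | is_tensor_index A k].

Definition is_drazin I (A X : tensor2 C I I) : Prop :=
  [/\ einstein (tensor_pow A (tensor_index A).+1) X
        = tensor_pow A (tensor_index A),
      einstein (einstein X A) X = X
    & einstein A X = einstein X A].

Definition drazin I (A : tensor2 C I I) : tensor2 C I I :=
  xget 0 [set X | is_drazin A X].

End EinsteinProduct.

(* Main.v *)
(** Enumerating multi-indices turns the Einstein product into the matrix product.
    Equality of the ranges of T^n and T^(n+1) then amounts to equality of their
    ranks; this gives the existence of the index, and also that T^n is both a
    left and a right multiple of T^(n+1), whence the Drazin inverse.
    The tensor M = A^k has index at most 1, so D = M^D satisfies M^2 D = M and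
    M D = D M.  Hence M and M^2 have the same null space, and B in the range of M
    gives M (D B) = B, so D B is a solution. *)

Require Import Defs.
From mathcomp Require Import all_boot all_order all_algebra.
From mathcomp Require Import boolp classical_sets reals complex.

Local Open Scope ring_scope.
Local Open Scope classical_set_scope.
Local Open Scope complex_scope.

Set Implicit Arguments.
Unset Strict Implicit.
Unset Printing Implicit Defensive.

Import GRing.Theory.

(** The inverse is [z ^+ n.+1 * a ^+ n]. Since [a ^+ n * y = z * a ^+ n.+1 * y = z * a ^+ n], powers
    of [y] on the right of [a ^+ n] can be traded for powers of [z] on the left, so multiplying this
    element by [a] on either side gives [z ^+ n * a ^+ n]. *)
Lemma strongly_pi_regular_drazin (R : pzRingType) (a y z : R) (n : nat) :
    a ^+ n = a ^+ n.+1 * y -> a ^+ n = z * a ^+ n.+1 ->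
  exists x, [/\ a ^+ n.+1 * x = a ^+ n, x * a * x = x & a * x = x * a].
Proof.
move=> ay za.
have swap m : a ^+ n * y ^+ m = z ^+ m * a ^+ n.
  elim: m => [|m IHm]; first by rewrite !expr0 mul1r mulr1.
  rewrite exprSr mulrA IHm exprSr -!mulrA; congr (_ * _).
  by rewrite {1}za -mulrA -ay.
have absorb m : z ^+ m * a ^+ (n + m) = a ^+ n.
  elim: m => [|m IHm]; first by rewrite addn0 mul1r.
  by rewrite exprSr addnS -addSn exprD -mulrA (mulrA z) -za -exprD.
have ax : a * (z ^+ n.+1 * a ^+ n) = z ^+ n * a ^+ n.
  by rewrite -swap mulrA -exprS [y ^+ _]exprS mulrA -ay swap.
have xa : z ^+ n.+1 * a ^+ n * a = z ^+ n * a ^+ n.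
  by rewrite -mulrA -exprSr exprSr -mulrA -za.
have comm : a * (z ^+ n.+1 * a ^+ n) = z ^+ n.+1 * a ^+ n * a by rewrite ax xa.
exists (z ^+ n.+1 * a ^+ n); split=> //.
- have /commrX <- : GRing.comm (z ^+ n.+1 * a ^+ n) a by rewrite /GRing.comm comm.
  by rewrite [a ^+ n.+1]exprS mulrA xa -mulrA -exprD absorb.
- by rewrite xa -(swap n.+1) mulrA -(mulrA (z ^+ n)) -exprD absorb.
Qed.

(** Otherwise each further power would lose at least one unit of rank, which is impossible for more
    than [n] steps. *)
Lemma expmx_rank_stable (F : fieldType) (n : nat) (M : 'M[F]_n) :
  exists m, \rank (M ^+ m) == \rank (M ^+ m.+1).
Proof.
apply: contrapT => /forallNP dec.
have bound m : (\rank (M ^+ m) + m <= n)%N.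
  elim: m => [|m IHm]; first by rewrite addn0 rank_leq_row.
  apply: leq_trans IHm; rewrite addnS ltn_add2r ltn_neqAle eq_sym.
  by apply/andP; split; [apply/negP/dec | rewrite exprS mxrankM_maxr].
by have := bound n.+1; rewrite addnS ltnNge leq_addl.
Qed.

Section TensorMatrix.
Variables (F : fieldType) (N : nat) (I : 'I_N -> nat).
Implicit Types (S T : tensor2 F I I) (X : tensor F I).

Definition tensor_mx T : 'M[F]_#|{: midx I}| :=
  \matrix_(i, j) T (enum_val i, enum_val j).

Definition mx_tensor (M : 'M[F]_#|{: midx I}|) : tensor2 F I I :=
  [ffun ij => M (enum_rank ij.1) (enum_rank ij.2)].

Definition tensor_col X : 'cV[F]_#|{: midx I}| := \col_i X (enum_val i).

Definition col_tensor (u : 'cV[F]_#|{: midx I}|) : tensor F I :=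
  [ffun i => u (enum_rank i) 0].

Lemma tensor_mxK : cancel tensor_mx mx_tensor.
Proof. by move=> T; apply/ffunP=> -[i j]; rewrite ffunE mxE !enum_rankK. Qed.

Lemma mx_tensorK : cancel mx_tensor tensor_mx.
Proof. by move=> M; apply/matrixP=> i j; rewrite mxE ffunE !enum_valK. Qed.

Lemma tensor_colK : cancel tensor_col col_tensor.
Proof. by move=> X; apply/ffunP=> i; rewrite ffunE mxE enum_rankK. Qed.

Lemma col_tensorK : cancel col_tensor tensor_col.
Proof. by move=> u; apply/colP=> i; rewrite mxE ffunE enum_valK. Qed.

Lemma tensor_mx_einstein S T :
  tensor_mx (einstein S T) = tensor_mx S *m tensor_mx T.
Proof.
apply/matrixP=> i j; rewrite !mxE ffunE /= big_enum_val /=.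
by apply: eq_bigr => l _; rewrite !mxE.
Qed.

Lemma tensor_col_app T X :
  tensor_col (einstein_app T X) = tensor_mx T *m tensor_col X.
Proof.
apply/colP=> i; rewrite !mxE ffunE big_enum_val /=.
by apply: eq_bigr => l _; rewrite !mxE.
Qed.

Lemma tensor_mx_pow T n : tensor_mx (tensor_pow T n) = tensor_mx T ^+ n.
Proof.
elim: n => [|n IHn]; last by rewrite /= tensor_mx_einstein IHn exprS.
apply/matrixP=> i j; rewrite mxE ffunE /= expr0 mxE.
by rewrite (inj_eq enum_val_inj).
Qed.

Lemma tensor_colD X Y : tensor_col (X + Y) = tensor_col X + tensor_col Y.
Proof. by apply/colP=> i; rewrite !mxE ffunE. Qed.

Lemma tensor_col0 : tensor_col 0 = 0.
Proof. by apply/colP=> i; rewrite !mxE ffunE. Qed.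

(** The range is a column space, whereas [%MS] compares row spaces; hence the transposes. *)
Lemma tensor_range_subset S T :
  tensor_range S `<=` tensor_range T <->
  ((tensor_mx S)^T <= (tensor_mx T)^T)%MS.
Proof.
split=> [sST | /submxP[D /(congr1 trmx)]].
  (* Each column of the matrix of [S] is the image of a standard basis vector, hence lies in the
     range of [T]. *)
  apply/row_subP=> i; rewrite -tr_col.
  have [|X _ TX] := sST (einstein_app S (col_tensor (delta_mx i 0))).
    by exists (col_tensor (delta_mx i 0)).
  have := congr1 tensor_col TX; rewrite !tensor_col_app col_tensorK => TXE.
  by rewrite colE -TXE trmx_mul submxMl.
rewrite trmx_mul !trmxK => SE _ [X _ <-].
exists (col_tensor (D^T *m tensor_col X)) => //.
apply: (can_inj tensor_colK).
by rewrite !tensor_col_app col_tensorK mulmxA SE.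
Qed.

(** The ranges are nested, so they agree as soon as their dimensions do. *)
Lemma tensor_range_pow_stableP T n :
  tensor_range (tensor_pow T n) = tensor_range (tensor_pow T n.+1) <->
  \rank (tensor_mx T ^+ n) = \rank (tensor_mx T ^+ n.+1).
Proof.
have sub : ((tensor_mx T ^+ n.+1)^T <= (tensor_mx T ^+ n)^T)%MS.
  by rewrite exprSr trmx_mul submxMl.
rewrite -[\rank (_ ^+ n)]mxrank_tr -[\rank (_ ^+ n.+1)]mxrank_tr.
rewrite -!tensor_mx_pow in sub *.
split=> [rE | rkE].
  by apply/eqP; rewrite eqn_leq !mxrankS //; apply/tensor_range_subset; rewrite rE.
apply/seteqP; split; apply/tensor_range_subset => //.
by rewrite -(geq_leqif (mxrank_leqif_sup sub)) rkE.
Qed.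

Lemma tensor_indexP T : is_tensor_index T (tensor_index T).
Proof.
rewrite /tensor_index; apply: (@xgetPex _ 0%N [set n | is_tensor_index T n]).
have [m /eqP rk min] := ex_minnP (expmx_rank_stable (tensor_mx T)).
exists m; split; first exact/tensor_range_pow_stableP.
by move=> j /tensor_range_pow_stableP/eqP/min.
Qed.

Lemma drazinP T : is_drazin T (drazin T).
Proof.
rewrite /drazin; apply: (@xgetPex _ 0 [set X | is_drazin T X]) => /=.
set n := tensor_index T; set a := tensor_mx T.
have rk : \rank (a ^+ n) = \rank (a ^+ n.+1).
  by apply/tensor_range_pow_stableP; case: (tensor_indexP T).
(* Equal ranks make the nested row spaces coincide, which gives [z]; the same argument on column
   spaces gives [y]. *)
have [z az] : exists z, a ^+ n = z * a ^+ n.+1.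
  have sub : (a ^+ n.+1 <= a ^+ n)%MS by rewrite exprS submxMl.
  by apply/submxP; rewrite -(geq_leqif (mxrank_leqif_sup sub)) rk.
have [y ay] : exists y, a ^+ n = a ^+ n.+1 * y.
  have sub : ((a ^+ n.+1)^T <= (a ^+ n)^T)%MS.
    by rewrite exprSr trmx_mul submxMl.
  have /submxP[y /(congr1 trmx)] : ((a ^+ n)^T <= (a ^+ n.+1)^T)%MS.
    by rewrite -(geq_leqif (mxrank_leqif_sup sub)) !mxrank_tr rk.
  by rewrite trmx_mul !trmxK; exists y^T.
have [x [ax xax comm]] := strongly_pi_regular_drazin ay az.
exists (mx_tensor x); split; apply: (can_inj tensor_mxK).
- by rewrite tensor_mx_einstein !tensor_mx_pow mx_tensorK.
- by rewrite !tensor_mx_einstein mx_tensorK.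
- by rewrite !tensor_mx_einstein mx_tensorK.
Qed.

(** Iterating [a ^+ k = z * a ^+ k.+1] gives [a ^+ k = z ^+ k * a ^+ (k + k)], so squaring [a ^+ k]
    preserves its rank. The index is 0 rather than 1 when [k] is 0, the power then being the
    identity. *)
Lemma tensor_pow_index_le1 T :
  (tensor_index (tensor_pow T (tensor_index T)) <= 1)%N.
Proof.
set k := tensor_index T; set a := tensor_mx T.
have [/tensor_range_pow_stableP rk _] := tensor_indexP T.
have [_] := tensor_indexP (tensor_pow T k); apply.
apply/tensor_range_pow_stableP; rewrite !tensor_mx_pow expr1 expr2 -exprD.
have sub : (a ^+ k.+1 <= a ^+ k)%MS by rewrite exprS submxMl.
have /submxP[z az] : (a ^+ k <= a ^+ k.+1)%MS.
  by rewrite -(geq_leqif (mxrank_leqif_sup sub)) rk.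
have absorb m : a ^+ k = z ^+ m * a ^+ (k + m).
  elim: m => [|m IHm]; first by rewrite addn0 mul1r.
  by rewrite exprSr addnS -addSn exprD -mulrA (mulrA z) -[z * _]az -exprD.
apply/eqP; rewrite eqn_leq {1}(absorb k) mxrankM_maxr.
by rewrite exprD mxrankM_maxr.
Qed.

End TensorMatrix.

Theorem theorem5p6 (R : realType) (N : nat) (hN : (0 < N)%N)
    (I : 'I_N -> nat) (hI : forall s, (0 < I s)%N)
    (A : tensor2 R[i] I I) (k : nat) (hk : tensor_index A = k)
    (B : tensor R[i] I) (hB : B \in tensor_range (tensor_pow A k)) :
  [set X : tensor R[i] I |
     einstein_app (tensor_pow A (2 * k)) X = einstein_app (tensor_pow A k) B]
  = [set einstein_app (drazin (tensor_pow A k)) B + Y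
       | Y in tensor_null (tensor_pow A k)].
Proof.
have := tensor_pow_index_le1 A; rewrite hk => idx1.
have [] := drazinP (tensor_pow A k).
set D := drazin _; set j := tensor_index _ in idx1 *.
move=> /(congr1 (@tensor_mx _ _ _)) MD _ /(congr1 (@tensor_mx _ _ _)).
have := tensor_mx_pow A (2 * k); rewrite mul2n -addnn exprD -tensor_mx_pow.
set M := tensor_mx (tensor_pow A k) in MD * => M2 comm.
rewrite tensor_mx_einstein !(tensor_mx_pow (tensor_pow A k)) -/M in MD.
rewrite !tensor_mx_einstein -/M in comm.
set d := tensor_mx D in MD comm.
have MMd : M *m M *m d = M.
  (* For [j = 1] this is [MD] itself; for [j = 0], [MD] says that [d] is a right inverse of [M]. *)
  case: (j) idx1 MD => [|[|//]] _; rewrite ?expr1 ?expr2 //.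
  by rewrite expr0 -mulmxA => ->; rewrite mulmx1.
have dMM : d *m M *m M = M by rewrite -comm -mulmxA -comm mulmxA.
move: hB; rewrite inE => -[Z _ BZ].
have Mdb : M *m (d *m tensor_col B) = tensor_col B.
  by rewrite -BZ tensor_col_app -/M (mulmxA d) -comm !mulmxA MMd.
have colI := can_inj (@tensor_colK R[i] N I).
apply/seteqP; split=> [X /= | _ [Y Y0 <-] /=].
  move=> /(congr1 (@tensor_col _ _ _)); rewrite !tensor_col_app M2 -/M => XE.
  exists (X - einstein_app D B); last by rewrite addrC subrK.
  have subE : tensor_col (X - einstein_app D B)
      = tensor_col X - d *m tensor_col B.
    by rewrite -tensor_col_app; apply/colP=> i; rewrite !mxE !ffunE.
  (* Writing [M] as [d *m M *m M] reduces the claim to [M *m M] killing the difference, which is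
     [XE] combined with [Mdb]. *)
  apply: colI; rewrite tensor_col_app tensor_col0 subE -/M -[in LHS]dMM -!mulmxA.
  by rewrite !mulmxBr Mdb [M *m (M *m tensor_col X)]mulmxA XE subrr.
apply: colI; rewrite !tensor_col_app M2 tensor_colD tensor_col_app -/M -/d.
have := congr1 (@tensor_col _ _ _) Y0; rewrite tensor_col_app tensor_col0 -/M => MY.
by rewrite -[M * M]/(M *m M) -mulmxA mulmxDr Mdb MY addr0.
Qed.
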